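(* There is a real constant $\gamma_0$ whose decimal expansion begins $\gamma_0=0.94349\ldots$, so that $0.94349\le\gamma_0<0.9435$, such that \[ F(N)\le N^{1/2}+\gamma_0N^{1/4}+O(1), \] that is, there is an absolute constant $C$ such that $F(N)\le N^{1/2}+\gamma_0N^{1/4}+C$ for all positive integers $N$.
   Context: A finite set $A\subset\mathbb{Z}$ is called Sidon if every nonzero difference has at most one ordered representation: whenever $a,b,c,d\in A$ satisfy $a-b=c-d\ne0$, then $(a,b)=(c,d)$. For a positive integer $N$, \[ F(N):=\max\bigl\{|A|:A\subset\{0,1,\ldots,N-1\}\text{ is Sidon}\bigr\}. \] *)

(* Defs.v *)
From HB Require Import structures.
From mathcomp Require Import all_boot all_order all_algebra finmap.
From mathcomp Require Import all_classical all_reals all_analysis.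

Set Implicit Arguments.
Unset Strict Implicit.
Unset Printing Implicit Defensive.

Import Order.TTheory GRing.Theory Num.Theory.
Local Open Scope fset_scope.
Local Open Scope ring_scope.

Definition sidon (A : {fset int}) : Prop :=
  forall a b c d : int, a \in A -> b \in A -> c \in A -> d \in A ->
    a - b = c - d -> a - b != 0 -> (a, b) = (c, d).

Definition int_initial (N : nat) : {fset int} := [fset i%:Z | i in iota 0 N].

Definition F (N : nat) : nat :=
  (\max_(A <- fpowerset (int_initial N) | `[< sidon A >]) #|` A|)%N.

(* Main.v *)
Require Import Defs.
From HB Require Import structures.
From mathcomp Require Import all_boot all_order all_algebra finmap.
From mathcomp Require Import ring lra zify.
From mathcomp Require Import all_classical all_reals all_analysis.

Set Implicit Arguments.
Unset Strict Implicit.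
Unset Printing Implicit Defensive.

Import Order.TTheory GRing.Theory Num.Theory numFieldNormedType.Exports.
Local Open Scope ring_scope.

(* A weighted Erdos-Turan argument.  Let S in [0, N) be Sidon with k elements,
   g x = T - x on [0, T), G = sum g, and
     Q = sum over a, b in S and x, y < T with a + x = b + y of g x * g y,
   the second moment of the windowed counts u |-> sum_(a in S) g (u - a).  As
   nonzero differences are represented at most once, Q <= G^2 + k sum g^2.

   For the lower bound, Cauchy-Schwarz with constant weights only sees an
   effective length N + T (each window overhangs both ends).  A decreasing g is
   more efficient at the left end: its mean is mu = (T - 1) / 3, not T / 2, and
   at the right end the reflected kernel plays that role.  To use both at once,
   with th = pi / (2 (N - 1)), bound Q below by inserting
     cos (th (a - b)) = cos (th a) cos (th b) + sin (th a) sin (th b) <= 1.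
   The cosine part is the second moment of S weighted towards the left end; the
   sine part is the same thing for the reflection of S.  Testing each against
   cos (th (u - mu)) costs only O((th T)^2) relatively, since g is centred at
   mu, and gives
     k^2 <~ (N + 2 mu) (1 + k sum g^2 / G^2) ~ (N + 2 T / 3) (1 + 4 k / (3 T)).
   With T ~ sqrt 2 * N^(3/4) this is
     k <= N^(1/2) + (2 sqrt 2 / 3 + o(1)) N^(1/4),
   and 2 sqrt 2 / 3 = 0.9428... < 0.94349; small N go into the constant C. *)

(** * Second moments: a lower bound by test functions, an upper bound from the Sidon property *)

Lemma sum_pick (R : pzRingType) (U p : nat) (f : nat -> R) : (p < U)%N ->
  \sum_(u < U) (p == u)%:R * f u = f p.
Proof.
move=> pU; rewrite (bigD1 (Ordinal pU)) //= eqxx mul1r big1 ?addr0 // => u.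
by rewrite eq_sym -val_eqE /= => /negPf ->; rewrite mul0r.
Qed.

(** With [s u] the total weight at position [u], the right side is the sum of [s u ^+ 2], so this is
    [(s u - t u) ^+ 2 >= 0] summed over [u]. The test function [t] stays free. *)
Lemma second_moment_lower (R : realFieldType) (J : finType) (P : pred J)
    (U : nat) (pos : J -> nat) (w : J -> R) (t : nat -> R) :
  (forall j, P j -> (pos j < U)%N) ->
  2 * (\sum_(j | P j) w j * t (pos j)) - \sum_(u < U) t u ^+ 2 <=
  \sum_(i | P i) \sum_(j | P j) w i * w j * (pos i == pos j)%:R.
Proof.
move=> posU; pose s (u : nat) := \sum_(j | P j) w j * (pos j == u)%:R.
have -> : \sum_(j | P j) w j * t (pos j) = \sum_(u < U) s u * t u.
  under [RHS]eq_bigr do rewrite mulr_suml.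
  rewrite exchange_big /=; apply: eq_bigr => j Pj.
  rewrite -(sum_pick t (posU j Pj)) mulr_sumr.
  by apply: eq_bigr => u _; rewrite mulrA.
have -> : \sum_(i | P i) \sum_(j | P j) w i * w j * (pos i == pos j)%:R =
    \sum_(u < U) s u ^+ 2.
  under [RHS]eq_bigr do rewrite expr2 mulr_suml.
  rewrite [RHS]exchange_big /=; apply: eq_bigr => i Pi.
  transitivity (w i * s (pos i)).
    rewrite /s mulr_sumr; apply: eq_bigr => j _.
    by rewrite mulrA eq_sym.
  rewrite -(sum_pick s (posU i Pi)) mulr_sumr.
  by apply: eq_bigr => u _; rewrite mulrA.
rewrite mulr_sumr -sumrB ler_sum // => u _.
by have := sqr_ge0 (s u - t u); nra.
Qed.

Lemma sum_pairs (R : nmodType) (I K : finType) (S : {set I})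
    (F : I * K -> I * K -> R) :
  \sum_(i | i.1 \in S) \sum_(j | j.1 \in S) F i j =
  \sum_(a in S) \sum_(b in S) \sum_x \sum_y F (a, x) (b, y).
Proof.
have flat (G : I * K -> R) :
    \sum_(i | i.1 \in S) G i = \sum_(a in S) \sum_x G (a, x).
  by rewrite pair_big_dep /=; apply: eq_big => [|[]] // i; rewrite andbT.
rewrite flat; apply: eq_bigr => a _.
under eq_bigr do rewrite flat.
by rewrite exchange_big.
Qed.

(** The equation [a - b = c - d] is written with sums because subtraction in [nat] truncates. *)
Definition sidon_ord (N : nat) (S : {set 'I_N}) : Prop :=
  forall a b c d, a \in S -> b \in S -> c \in S -> d \in S ->
    (a + d = c + b)%N -> a != b -> a = c /\ b = d.

(** For fixed [x] and [y], the equation reads [a - b = y - x]: it has [#|S|] solutions if [x = y],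
    and at most one otherwise. *)
Lemma sidon_second_moment (R : realFieldType) (N T : nat) (S : {set 'I_N})
    (g : 'I_T -> R) : (forall x, 0 <= g x) ->
  sidon_ord S ->
  \sum_(a in S) \sum_(b in S) \sum_x \sum_y
     g x * g y * (a + x == b + y)%N%:R <=
  (\sum_x g x) ^+ 2 + #|S|%:R * \sum_x g x ^+ 2.
Proof.
move=> g0 sidS.
have count (x y : 'I_T) :
    (\sum_(a in S) \sum_(b in S) (a + x == b + y)%N%:R <=
     1 + (x == y)%:R * #|S|%:R :> R).
  case: (eqVneq x y) => [<-|xy].
    rewrite mul1r -[leLHS]addr0 addrC lerD // -sum1_card natr_sum ler_sum //.
    move=> a aS; rewrite (bigD1 a) //= eqxx big1 ?addr0 // => b /andP[_ ba].
    by rewrite eqn_add2r val_eqE eq_sym (negPf ba).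
  rewrite mul0r addr0.
  under eq_bigr do rewrite -natr_sum.
  rewrite -natr_sum -[1]/(1%:R) ler_nat pair_big /= -big_mkcondr /= sum1_card.
  apply/card_le1P => -[a b].
  rewrite unfold_in /= => /andP[/andP[aS bS] /eqP ab] [c d].
  rewrite [LHS]unfold_in inE /=.
  apply/andP/eqP => [[/andP[cS dS] /eqP cd]|[-> ->]].
    have [||-> ->//] := sidS a b c d aS bS cS dS; first by lia.
    apply: contra xy => /eqP E; apply/eqP/val_inj => /=.
    by rewrite E in ab; lia.
  by rewrite aS bS ab eqxx.
under eq_bigr => a _ do rewrite exchange_big.
under eq_bigr => a _ do under eq_bigr => x _ do rewrite exchange_big.
rewrite exchange_big.
under eq_bigr => x _ do rewrite exchange_big.
apply: (@le_trans _ _ (\sum_x \sum_y g x * g y * (1 + (x == y)%:R * #|S|%:R))).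
  apply: ler_sum => x _; apply: ler_sum => y _ /=.
  rewrite (le_trans _ (ler_wpM2l _ (count x y))) ?mulr_ge0 //.
  rewrite mulr_sumr ler_sum // => a _; rewrite mulr_sumr ler_sum // => b _.
rewrite expr2 mulr_suml mulr_sumr -big_split /= ler_sum // => x _.
rewrite mulr_sumr.
under eq_bigr do rewrite mulrDr mulr1.
rewrite big_split /= lerD2l (bigD1 x) //= eqxx big1 ?addr0.
  by rewrite mul1r mulrC.
by move=> y /negPf; rewrite eq_sym => ->; rewrite mul0r mulr0.
Qed.

(** * Elementary estimates for sine and cosine *)

Lemma norm_sin_le (R : realType) (y : R) : 0 <= y -> `|sin y| <= y.
Proof.
move=> y0; have [|z _] := @MVT_segment _ sin cos _ _ y0.
  exact/continuous_subspaceT/continuous_sin.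
by rewrite sin0 !subr0 => ->; rewrite normrM (ger0_norm y0) ler_piMl ?cos_max.
Qed.

Lemma cos_ge_quad (R : realType) (y : R) : 1 - y ^+ 2 / 2 <= cos y.
Proof.
wlog y0 : y / 0 <= y.
  move=> H; have [|/ltW] := leP 0 y; first exact: H.
  by rewrite -oppr_ge0 -cosN -sqrrN; apply: H.
have E : y = (y / 2) *+ 2 by lra.
rewrite {2}E cos_mulr2n cos2sin2.
have : sin (y / 2) ^+ 2 <= (y / 2) ^+ 2.
  rewrite -[_ ^+ 2]real_normK ?num_real //.
  rewrite lerXn2r ?nnegrE ?normr_ge0 //; first lra.
  apply: norm_sin_le; lra.
rewrite -mulr_natr; nra.
Qed.

Lemma sin_ge_cubic (R : realType) (y : R) : 0 <= y -> y - y ^+ 3 / 2 <= sin y.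
Proof.
move=> y0; have [|z] := @MVT_segment _ sin cos _ _ y0.
  exact/continuous_subspaceT/continuous_sin.
rewrite in_itv /= sin0 !subr0 => /andP[z0 zy] ->.
have := cos_ge_quad z.
have : z ^+ 2 <= y ^+ 2 by rewrite ler_sqr ?nnegrE.
nra.
Qed.

Lemma sin_sub_norm (R : realType) (y : R) :
  `|y| <= 1 -> `|sin y - y| <= y ^+ 2 / 2.
Proof.
wlog y0 : y / 0 <= y.
  move=> H; have [|/ltW] := leP 0 y; first exact: H.
  rewrite -oppr_ge0 -[ `|y|]normrN -[X in _ -> _ -> X <= _]normrN opprB.
  have -> : y - sin y = sin (- y) - (- y) by rewrite sinN; ring.
  by rewrite -sqrrN; apply: H.
rewrite ger0_norm // => y1; have := sin_ge_cubic y0; have := norm_sin_le y0.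
rewrite !ler_norml => /andP[_ ?] ?; apply/andP; split; nra.
Qed.

(** Telescoping of [2 sin (d / 2) cos v = sin (v + d / 2) - sin (v - d / 2)]. *)
Lemma sum_cos_arith (R : realType) (z d : R) (n : nat) :
  2 * sin (d / 2) * (\sum_(u < n) cos (z + u%:R * d)) =
  sin (z + n%:R * d - d / 2) - sin (z - d / 2).
Proof.
elim: n => [|n IH]; first by rewrite big_ord0 mulr0 mul0r addr0 subrr.
rewrite big_ord_recr /= mulrDr IH.
set v := z + n%:R * d.
have -> : z + n.+1%:R * d - d / 2 = v + d / 2 by rewrite /v -natr1; field.
by rewrite (sinD v (d / 2)) !sinB; ring.
Qed.

(** * Cosine-weighted lower bounds from the two ends *)

(** The weights [cos (th * pos a) * g x] are tested against [c * cos (th * (u - mu))], expanded by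
    the addition formula. Here [pos] will be the identity or the reversal; [c] is optimised
    later. *)
Lemma cos_window_lower (R : realType) (N T : nat) (S : {set 'I_N})
    (pos : 'I_N -> 'I_N) (g : 'I_T -> R) (th mu c : R) :
  2 * c * (\sum_(a in S) (cos (th * (pos a)%:R) ^+ 2 *
               (\sum_x g x * cos (th * (x%:R - mu)))
             - cos (th * (pos a)%:R) * sin (th * (pos a)%:R) *
               (\sum_x g x * sin (th * (x%:R - mu)))))
    - c ^+ 2 * (\sum_(u < N + T) cos (th * (u%:R - mu)) ^+ 2) <=
  \sum_(a in S) \sum_(b in S) \sum_x \sum_y
     g x * g y * (cos (th * (pos a)%:R) * cos (th * (pos b)%:R)) *
     (pos a + x == pos b + y)%N%:R.
Proof.
pose w (j : 'I_N * 'I_T) : R := cos (th * (pos j.1)%:R) * g j.2.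
pose p (j : 'I_N * 'I_T) := (pos j.1 + j.2)%N.
pose t (u : nat) : R := c * cos (th * (u%:R - mu)).
have := @second_moment_lower R _ (fun j => j.1 \in S) (N + T) p w t.
rewrite sum_pairs => H.
apply: le_trans (le_trans (H _) _); last 2 first.
- by move=> j _; rewrite /p -addSn leq_add // ltnW.
- apply: ler_sum => a _; apply: ler_sum => b _.
  apply: ler_sum => x _; apply: ler_sum => y _.
  by rewrite /w /p /= le_eqVlt; apply/orP; left; apply/eqP; ring.
have -> : c ^+ 2 * (\sum_(u < N + T) cos (th * (u%:R - mu)) ^+ 2) =
    \sum_(u < N + T) t u ^+ 2.
  by rewrite mulr_sumr; apply: eq_bigr => u _; rewrite exprMn.
rewrite lerD2r le_eqVlt; apply/orP; left; apply/eqP.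
rewrite -mulrA; congr (2 * _).
transitivity (\sum_(a in S) \sum_x w (a, x) * t (p (a, x))); last first.
  by rewrite pair_big_dep /=; apply: eq_big => [|[]] // i; rewrite andbT.
rewrite mulr_sumr; apply: eq_bigr => a _.
rewrite !mulr_sumr -sumrB mulr_sumr; apply: eq_bigr => x _.
rewrite /w /t /p /= natrD.
have -> : th * ((pos a)%:R + x%:R - mu) =
    th * (pos a)%:R + th * (x%:R - mu) :> R.
  by ring.
rewrite cosD; ring.
Qed.

(** As [th * M = pi / 2], reversal exchanges cosine and sine. Adding the two bounds, the squares sum
    to 1, the products combine to [cos (th * (a - b)) <= 1], and the cross terms cost at most the
    absolute value of the sine sum. *)
Lemma cos_split_lower (R : realType) (M T : nat) (S : {set 'I_M.+1})
    (g : 'I_T -> R) (th mu c : R) :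
  (forall x, 0 <= g x) -> th * M%:R = pi / 2 -> 0 <= c ->
  2 * c * (#|S|%:R * ((\sum_x g x * cos (th * (x%:R - mu)))
                       - `|\sum_x g x * sin (th * (x%:R - mu))|))
    - 2 * c ^+ 2 * (\sum_(u < M.+1 + T) cos (th * (u%:R - mu)) ^+ 2) <=
  \sum_(a in S) \sum_(b in S) \sum_x \sum_y
     g x * g y * (a + x == b + y)%N%:R.
Proof.
move=> g0 thM c0.
set C := \sum_x _ * cos _; set D := \sum_x _ * sin _; set V := \sum_(u < _) _.
have L := cos_window_lower S id g th mu c.
have L' := cos_window_lower S (@rev_ord _) g th mu c.
rewrite -/C -/D -/V in L L'; rewrite /= in L.
have threv (a : 'I_M.+1) : th * (rev_ord a)%:R = pi / 2 - th * a%:R.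
  by rewrite /= subSS natrB ?mulrBr ?thM // -ltnS.
have cosr (a : 'I_M.+1) : cos (th * (rev_ord a)%:R) = sin (th * a%:R).
  by rewrite threv -opprB cosN cosBpihalf.
have sinr (a : 'I_M.+1) : sin (th * (rev_ord a)%:R) = cos (th * a%:R).
  by rewrite threv -opprB sinN sinBpihalf opprK.
have LL := lerD L L'.
apply: le_trans (le_trans LL _); last first.
  rewrite -big_split /= ler_sum // => a _.
  rewrite -big_split /= ler_sum // => b _.
  (* Reflection reverses the sign of [a - b], so [x] and [y] swap roles in the reversed copy. *)
  rewrite [X in _ + X]exchange_big -big_split /= ler_sum // => x _.
  rewrite -big_split /= ler_sum // => y _.
  rewrite !cosr.
  have -> : (M.+1 - a.+1 + y == M.+1 - b.+1 + x)%N = (a + x == b + y)%N.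
    by apply/eqP/eqP; have := ltn_ord a; have := ltn_ord b; lia.
  rewrite [g y * g x]mulrC -mulrDl -mulrDr -cosB ler_wpM2r //.
  by rewrite ler_piMr ?cos_le1 // mulr_ge0.
suff : #|S|%:R * (C - `|D|) <=
    \sum_(a in S) (cos (th * a%:R) ^+ 2 * C -
       cos (th * a%:R) * sin (th * a%:R) * D) +
    \sum_(a in S) (cos (th * (rev_ord a)%:R) ^+ 2 * C -
       cos (th * (rev_ord a)%:R) * sin (th * (rev_ord a)%:R) * D).
  have c2 : 0 <= 2 * c by lra.
  move=> /(ler_wpM2l c2); rewrite mulrDr; lra.
rewrite -big_split /= mulr_natl -sumr_const ler_sum // => a _.
rewrite cosr sinr.
have := cos2Dsin2 (th * a%:R); set u := cos _; set v := sin _ => uv.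
have -> : u ^+ 2 * C - u * v * D + (v ^+ 2 * C - v * u * D) =
    (u ^+ 2 + v ^+ 2) * C - 2 * u * v * D by ring.
rewrite uv mul1r.
rewrite lerD2l lerN2 (le_trans (ler_norm _)) // normrM ler_piMl //.
by rewrite ler_norml; have := sqr_ge0 (u + v); have := sqr_ge0 (u - v); nra.
Qed.

(** * The triangular kernel and its Fourier sums *)

Lemma sum_tri (R : realType) (T : nat) :
  \sum_(x < T) (T - x)%:R = T%:R * (T%:R + 1) / 2 :> R.
Proof.
elim: T => [|T IH]; first by rewrite big_ord0; ring.
rewrite big_ord_recl subn0 -[X in _ + X]/(\sum_(i < T) (T - i)%:R) IH -natr1.
by field.
Qed.

Lemma sum_tri_sqr (R : realType) (T : nat) :
  \sum_(x < T) (T - x)%:R ^+ 2 =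
  T%:R * (T%:R + 1) * (2 * T%:R + 1) / 6 :> R.
Proof.
elim: T => [|T IH]; first by rewrite big_ord0; ring.
rewrite big_ord_recl subn0 -[X in _ + X]/(\sum_(i < T) (T - i)%:R ^+ 2).
by rewrite IH -natr1; field.
Qed.

Lemma tri_centered (R : realType) (T : nat) :
  \sum_(x < T) (T - x)%:R * (x%:R - (T%:R - 1) / 3) = 0 :> R.
Proof.
transitivity (\sum_(x < T)
    ((T - x)%:R * (T%:R - (T%:R - 1) / 3) - (T - x)%:R ^+ 2) : R).
  apply: eq_bigr => x _; rewrite natrB; last exact/ltnW.
  by field.
by rewrite sumrB -mulr_suml sum_tri sum_tri_sqr; field.
Qed.

Lemma tri_mean_dist (R : realType) (T : nat) (x : 'I_T) :
  (x%:R - (T%:R - 1) / 3) ^+ 2 <= T%:R ^+ 2 :> R.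
Proof.
have : x%:R + 1 <= T%:R :> R by rewrite natr1 ler_nat.
have : 0 <= x%:R :> R by [].
nra.
Qed.

(** Centring at [mu] removes the linear part of the sine, so the cosine deficit and the sine sum
    each cost at most half of [(th * T) ^ 2] relative to the total mass. *)
Lemma tri_fourier (R : realType) (T : nat) (th : R) (mu := (T%:R - 1) / 3) :
  0 <= th -> th * T%:R <= 1 ->
  (\sum_(x < T) (T - x)%:R) * (1 - (th * T%:R) ^+ 2) <=
  (\sum_(x < T) (T - x)%:R * cos (th * (x%:R - mu)))
    - `|\sum_(x < T) (T - x)%:R * sin (th * (x%:R - mu))|.
Proof.
move=> th0 thT.
set G := \sum_(x < T) _.
have dist (x : 'I_T) : (th * (x%:R - mu)) ^+ 2 <= (th * T%:R) ^+ 2.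
  by rewrite !exprMn ler_wpM2l ?sqr_ge0 ?tri_mean_dist.
have cosG : G * (1 - (th * T%:R) ^+ 2 / 2) <=
    \sum_(x < T) (T - x)%:R * cos (th * (x%:R - mu)).
  rewrite mulr_suml ler_sum // => x _; rewrite ler_wpM2l //.
  by have := cos_ge_quad (th * (x%:R - mu)); have := dist x; lra.
suff : `|\sum_(x < T) (T - x)%:R * sin (th * (x%:R - mu))| <=
    G * ((th * T%:R) ^+ 2 / 2) by move: cosG; lra.
have -> : \sum_(x < T) (T - x)%:R * sin (th * (x%:R - mu)) =
    \sum_(x < T) (T - x)%:R * (sin (th * (x%:R - mu)) - th * (x%:R - mu)).
  under [RHS]eq_bigr do rewrite mulrBr mulrCA.
  by rewrite sumrB -mulr_sumr tri_centered mulr0 subr0.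
rewrite (le_trans (ler_norm_sum _ _ _)) // mulr_suml ler_sum // => x _.
rewrite normrM ger0_norm // ler_wpM2l //.
rewrite (le_trans (sin_sub_norm _)) //; last by have := dist x; lra.
rewrite -(@ler_pXn2r _ 2) ?nnegrE // real_normK ?num_real // expr1n.
apply: le_trans (dist x) _; rewrite expr_le1 // mulr_ge0 //.
Qed.

(** Doubling the angle leaves the length [M + 1 + T] plus a cosine sum [W] over slightly more than
    one half-turn. Its two ends nearly cancel, leaving [W] about [- T / 3]; this turns the overhang
    [T] into [2 T / 3]. *)
Lemma cos_sqr_sum_le (R : realType) (M T : nat) (th : R)
    (mu := (T%:R - 1) / 3) :
  (0 < T)%N -> 0 < th <= 1 -> th * M%:R = pi / 2 ->
  2 * (\sum_(u < M.+1 + T) cos (th * (u%:R - mu)) ^+ 2) <=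
  M.+1%:R + 2 / 3 * T%:R + 14 * (th * T%:R) ^+ 2 * T%:R.
Proof.
move=> T0 /andP[th0 th1] thM.
have T1 : 1 <= T%:R :> R by rewrite ler1n.
set W := \sum_(u < M.+1 + T) cos (- (2 * th * mu) + u%:R * (2 * th)).
have -> : 2 * (\sum_(u < M.+1 + T) cos (th * (u%:R - mu)) ^+ 2) =
    (M.+1 + T)%:R + W.
  rewrite mulr_sumr -[(M.+1 + T)%N in RHS]card_ord -sumr_const -big_split /=.
  apply: eq_bigr => u _.
  have -> : - (2 * th * mu) + u%:R * (2 * th) = (th * (u%:R - mu)) *+ 2 :> R.
    by rewrite -mulr_natr; ring.
  by rewrite cos_mulr2n -mulr_natr; ring.
have := sum_cos_arith (- (2 * th * mu)) (2 * th) (M.+1 + T); rewrite -/W.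
have -> : 2 * th / 2 = th by field.
pose p : R := 2 * mu + 1; pose r : R := 2 * (T%:R - mu) + 1.
have -> : - (2 * th * mu) - th = - (th * p) by rewrite /p; ring.
have -> : - (2 * th * mu) + (M.+1 + T)%:R * (2 * th) - th = th * r + pi.
  have -> : pi = 2 * (th * M%:R) :> R by rewrite thM; field.
  by rewrite /r natrD -natr1; ring.
rewrite (sinDpi _ : sin (_ + pi) = - sin _) sinN opprK => WE.
have p0 : 0 <= th * p by rewrite mulr_ge0 ?(ltW th0) // /p /mu; lra.
have r0 : 0 <= th * r by rewrite mulr_ge0 ?(ltW th0) // /r /mu; lra.
have rT : r <= 3 * T%:R by rewrite /r /mu; lra.
have sp : sin (th * p) <= th * p.
  by have := norm_sin_le p0; rewrite ler_norml => /andP[].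
have sr := sin_ge_cubic r0.
have s1 : sin th <= th.
  by have := norm_sin_le (ltW th0); rewrite ler_norml => /andP[].
have s2 : th / 2 <= sin th by have := sin_ge_cubic (ltW th0); nra.
have s0 : 0 < sin th by lra.
have {}WE : 2 * sin th * W <= th * (p - r) + (th * r) ^+ 3 / 2.
  by rewrite WE; lra.
have r3 : r ^+ 3 <= (3 * T%:R) ^+ 3.
  by rewrite lerXn2r ?nnegrE // /r /mu; lra.
suff : W <= (p - r) / 2 + 14 * (th * T%:R) ^+ 2 * T%:R.
  by rewrite natrD /p /r /mu; lra.
rewrite -(ler_pM2l (_ : 0 < 2 * sin th)); last lra.
apply: le_trans WE _.
(* Since [p - r <= 0], the main term uses [sin th <= th]; the error term uses [th <= 2 * sin th],
   with [3 ^ 3 / 2 <= 14]. *)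
rewrite [leRHS]mulrDr lerD //.
  have : p - r <= 0 by rewrite /p /r /mu; lra.
  by nra.
apply: (@le_trans _ _ (th * (14 * (th * T%:R) ^+ 2 * T%:R))); last first.
  by rewrite ler_wpM2r ?mulr_ge0 ?sqr_ge0 //; lra.
rewrite exprMn.
apply: (@le_trans _ _ (th ^+ 3 * (3 * T%:R) ^+ 3 / 2)).
  by rewrite ler_wpM2r // ler_wpM2l // exprn_ge0 // ltW.
have : 0 <= th ^+ 3 * T%:R ^+ 3 by rewrite mulr_ge0 ?exprn_ge0 // ltW.
by lra.
Qed.

(** * The quadratic inequality for the size of a Sidon set *)

Lemma sidon_card_ineq (R : realType) (M T : nat) (S : {set 'I_M.+1})
    (eps := pi / 2 / M%:R * T%:R : R) :
  (1 < M)%N -> (0 < T)%N -> eps <= 1 ->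
  sidon_ord S ->
  #|S|%:R ^+ 2 * (1 - eps ^+ 2) ^+ 2 <=
  (M.+1%:R + 2 / 3 * T%:R + 14 * eps ^+ 2 * T%:R) *
  (1 + 4 / 3 * #|S|%:R / T%:R).
Proof.
move=> M1 T0 eps1 sidS.
set k : R := #|S|%:R.
pose th : R := pi / 2 / M%:R.
have M0 : 0 < M%:R :> R by rewrite ltr0n; lia.
have thM : th * M%:R = pi / 2 by rewrite /th divfK // gt_eqF.
have th0 : 0 < th by rewrite divr_gt0 // divr_gt0 ?pi_gt0.
have th1 : th <= 1.
  rewrite /th ler_pdivrMr // mul1r (le_trans (ltW (pihalf_lt2 R))) //.
  by rewrite ler_nat.
have T1 : 1 <= T%:R :> R by rewrite ler1n.
set V2 := _ + 14 * _ * _.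
pose g (x : 'I_T) : R := (T - x)%:R.
pose mu : R := (T%:R - 1) / 3.
have g0 x : 0 <= g x by [].
have up := sidon_second_moment g0 sidS.
have := cos_sqr_sum_le T0 (introT andP (conj th0 th1)) thM.
rewrite -/eps -/V2 => V2ge.
have low c (c0 : 0 <= c) := le_trans (cos_split_lower S mu g0 thM c0) up.
have := tri_fourier (ltW th0) eps1; rewrite -/eps -/mu.
set G := \sum_(x < T) _ => Dge.
have G0 : 0 < G.
  by rewrite /G sum_tri; nra.
have H0 : \sum_x g x ^+ 2 <= 4 / 3 / T%:R * G ^+ 2.
  rewrite /G /g sum_tri sum_tri_sqr -subr_ge0.
  have -> : 4 / 3 / T%:R * (T%:R * (T%:R + 1) / 2) ^+ 2 -
    T%:R * (T%:R + 1) * (2 * T%:R + 1) / 6 = T%:R * (T%:R + 1) / 6 :> R.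
    by field; lra.
  by nra.
have V20 : 0 < V2.
  have := mulr_ge0 (mulr_ge0 (ler0n R 14) (sqr_ge0 eps)) (ler0n R T).
  by rewrite /V2 -natr1; lra.
pose y := G * (1 - eps ^+ 2).
have y0 : 0 <= y.
  rewrite mulr_ge0 ?(ltW G0) // subr_ge0 expr_le1 // /eps.
  by rewrite mulr_ge0 // ltW.
have k0 : 0 <= k by [].
have main : k ^+ 2 * y ^+ 2 / V2 <= G ^+ 2 + k * \sum_x g x ^+ 2.
  (* This value of [c] maximises [2 * c * k * y - c ^ 2 * V2]. *)
  have c0 : 0 <= k * y / V2 := divr_ge0 (mulr_ge0 k0 y0) (ltW V20).
  apply: le_trans (low _ c0).
  apply: (@le_trans _ _ (2 * (k * y / V2) * (k * y) - (k * y / V2) ^+ 2 * V2)).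
    rewrite le_eqVlt; apply/orP; left; apply/eqP; field.
    by rewrite gt_eqF.
  apply: lerB.
    exact: ler_wpM2l (mulr_ge0 (ler0n _ 2) c0) _ _ (ler_wpM2l k0 Dge).
  by rewrite mulrAC mulrC ler_wpM2l ?sqr_ge0.
rewrite -(ler_pM2r (exprn_gt0 2 G0)).
have -> : k ^+ 2 * (1 - eps ^+ 2) ^+ 2 * G ^+ 2 = k ^+ 2 * y ^+ 2.
  by rewrite /y; ring.
rewrite -[leRHS]mulrA -ler_pdivrMl // [leLHS]mulrC (le_trans main) //.
rewrite mulrDl mul1r lerD2l.
rewrite (le_trans (ler_wpM2l k0 H0)) // le_eqVlt; apply/orP; left; apply/eqP.
by field; lra.
Qed.

(** * Extremal sets and the asymptotic bound *)

Lemma F_attained (N : nat) : exists2 S : {set 'I_N}, F N = #|S| & sidon_ord S.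
Proof.
rewrite /F big_seq_cond.
pose P m := exists2 S : {set 'I_N}, m = #|S| & sidon_ord S.
apply: (big_ind P).
(* The empty set accounts for the default value 0 of the maximum. *)
- by exists finset.set0; rewrite ?cards0 // => a b c d; rewrite inE.
- move=> m n Hm Hn; rewrite -[X in P X]/(maxn m n).
  by have [->|->] : maxn m n = m \/ maxn m n = n by lia.
move=> A /andP[]; rewrite fpowersetE => /fsubsetP AN /asboolP sidA.
exists [set i : 'I_N | (i : nat)%:Z \in A].
  rewrite cardE -(size_map (fun i : 'I_N => (i : nat)%:Z)).
  apply/perm_size/uniq_perm; first exact: fset_uniq.
    by rewrite map_inj_uniq ?enum_uniq // => i j [] /val_inj.
  move=> z; apply/idP/mapP => [zA|[i]]; last by rewrite mem_enum inE => ? ->.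
  have /imfsetP[/= i] := AN z zA; rewrite mem_iota add0n /= => iN zi.
  by exists (Ordinal iN) => //; rewrite mem_enum inE -zi.
move=> a b c d; rewrite !inE => aA bA cA dA adcb ab.
have [] : ((a : nat)%:Z, (b : nat)%:Z) = ((c : nat)%:Z, (d : nat)%:Z).
  apply: sidA => //; first by lia.
  by rewrite subr_eq0; apply: contra ab => /eqP[/val_inj ->].
by move=> /val_inj -> /val_inj ->.
Qed.

(** The ratio [be * (1 + ka * k) / k ^ 2] decreases in [k]. A size above the claimed bound [k0] can
    thus be replaced by [k0] itself. *)
Lemma quadratic_ratio_le (R : realFieldType) (X be ka k k0 : R) :
  0 < k0 -> k0 <= k -> 0 <= be -> 0 <= ka ->
  X * k ^+ 2 <= be * (1 + ka * k) -> X * k0 ^+ 2 <= be * (1 + ka * k0).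
Proof.
move=> k00 k0k be0 ka0 H.
have kp : 0 < k by lra.
rewrite -(ler_pM2r (exprn_gt0 2 kp)).
apply: (@le_trans _ _ (k0 ^+ 2 * (be * (1 + ka * k)))).
  have := ler_wpM2l (sqr_ge0 k0) H; lra.
rewrite [leLHS]mulrCA -[leRHS]mulrA ler_wpM2l //.
have e1 : k0 ^+ 2 <= k ^+ 2 by rewrite lerXn2r ?nnegrE // ltW.
have e2 : ka * (k0 * k * k0) <= ka * (k0 * k * k).
  by rewrite !ler_wpM2l // mulr_ge0 // ltW.
by rewrite !mulrDr !mulrDl; lra.
Qed.

(* 41 / 29 approximates sqrt 2 (the optimal scale of T); 33 / 35 and 50 / 53
   slightly exceed 2 / 3 * (41 / 29) and 4 / 3 / (41 / 29), whose sum is close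
   to 4 sqrt 2 / 3 < 2 * (50 / 53). *)
Lemma asymptotic_card_le (R : realFieldType) (q k T e ga : R) :
  50 / 53 <= ga <= 1 -> 200 * 300 <= q -> 0 <= e -> e * q <= 3 ->
  41 / 29 * q ^+ 3 <= T <= 41 / 29 * q ^+ 3 + 1 ->
  k ^+ 2 * (1 - e ^+ 2) ^+ 2 <=
    (q ^+ 4 + 2 / 3 * T + 14 * e ^+ 2 * T) * (1 + 4 / 3 * k / T) ->
  k <= q ^+ 2 + ga * q.
Proof.
move=> /andP[ga1 ga2] qK e0 eq3 /andP[Tlo Thi] H.
rewrite leNgt; apply/negP => /ltW kk0.
have ga0 : 0 < ga by lra.
have q0 : 0 < q by lra.
have q30 : 0 < q ^+ 3 by rewrite exprn_gt0.
have T0 : 0 < T by lra.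
have k00 : 0 < q ^+ 2 + ga * q by rewrite addr_gt0 ?exprn_gt0 ?mulr_gt0.
have e2q : (e * q) ^+ 2 <= 9 by have := mulr_ge0 e0 (ltW q0); nra.
set k0 := q ^+ 2 + _ in kk0 k00.
have q2 : 100 * 100 * q <= q ^+ 2 by rewrite expr2 ler_wpM2r ?(ltW q0) //; lra.
have q3 : 100 * 100 * q ^+ 2 <= q ^+ 3.
  by rewrite [leRHS]exprS ler_wpM2r ?sqr_ge0 //; lra.
have X : 1 - 18 / q ^+ 2 <= (1 - e ^+ 2) ^+ 2.
  apply: (@le_trans _ _ (1 - 2 * e ^+ 2)); last first.
    by have := sqr_ge0 (e ^+ 2); lra.
  rewrite lerD2l lerN2 ler_pdivlMr ?exprn_gt0 // -mulrA -exprMn; lra.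
set be := _ + 14 * _ * _ in H.
have be0 : 0 <= be.
  have := mulr_ge0 (mulr_ge0 (ler0n R 14) (sqr_ge0 e)) (ltW T0).
  by have := exprn_gt0 4 q0; rewrite /be; lra.
have H1 : (1 - 18 / q ^+ 2) * k ^+ 2 <= be * (1 + (4 / 3 / T) * k).
  rewrite (_ : 4 / 3 / T * k = 4 / 3 * k / T); last by rewrite mulrAC.
  by apply: le_trans H; rewrite mulrC ler_wpM2l ?sqr_ge0.
have ka0 : 0 <= 4 / 3 / T by rewrite divr_ge0 ?(ltW T0) //; lra.
have {}H1 := quadratic_ratio_le k00 kk0 be0 ka0 H1.
have be1 : be <= q ^+ 4 + 33 / 35 * q ^+ 3 + 200 * q.
  have : 14 * e ^+ 2 * T <= 200 * q.
    rewrite -(ler_pM2r (exprn_gt0 2 q0)).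
    have -> : 14 * e ^+ 2 * T * q ^+ 2 = 14 * (e * q) ^+ 2 * T by ring.
    have : (e * q) ^+ 2 * T <= 9 * T by rewrite ler_wpM2r // ltW.
    have -> : 200 * q * q ^+ 2 = 200 * q ^+ 3 by ring.
    lra.
  by rewrite /be; lra.
have ka1 : 1 + 4 / 3 / T * k0 <= 1 + 50 / 53 / q.
  rewrite lerD2l mulrAC ler_pdivrMr // mulrAC [leRHS]mulrAC ler_pdivlMr //.
  have : ga * q ^+ 2 <= 1 * q ^+ 2 by rewrite ler_wpM2r ?sqr_ge0.
  have : 4 / 3 * k0 * q = 4 / 3 * q ^+ 3 + 4 / 3 * (ga * q ^+ 2).
    by rewrite /k0; ring.
  lra.
have H2 : (1 - 18 / q ^+ 2) * k0 ^+ 2 <=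
    (q ^+ 4 + 33 / 35 * q ^+ 3 + 200 * q) * (1 + 50 / 53 / q).
  apply: le_trans H1 _; apply: ler_pM => //.
  by rewrite addr_ge0 // mulr_ge0 // ltW.
clear X H H1 be0 be1 ka0 ka1 be eq3 e2q e0 Tlo Thi T0.
have : (q ^+ 2 - 18) * (q + ga) ^+ 2 <=
    (q ^+ 3 + 33 / 35 * q ^+ 2 + 200) * (q + 50 / 53).
  have qn0 := lt0r_neq0 q0.
  rewrite (_ : (q ^+ 2 - 18) * _ = (1 - 18 / q ^+ 2) * k0 ^+ 2); last first.
    by rewrite /k0; field.
  rewrite (_ : _ * (q + _) = (q ^+ 4 + 33 / 35 * q ^+ 3 + 200 * q)
    * (1 + 50 / 53 / q)) //; by field.
apply/negP; rewrite -ltNge -subr_gt0.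
(* The quartic terms cancel. The cubic coefficient is at least [50 / 53 - 33 / 35 = 1 / 1855], so
   [q >= 60000] makes [s] exceed 1, and [q ^ 2] then beats the lower-order terms. *)
pose s := q * (2 * ga - 33 / 35 - 50 / 53) + ga ^+ 2 - 18 - 33 / 35 * (50 / 53).
have -> : (q ^+ 2 - 18) * (q + ga) ^+ 2 -
    (q ^+ 3 + 33 / 35 * q ^+ 2 + 200) * (q + 50 / 53) =
    q ^+ 2 * s - q * (36 * ga + 200) - 18 * ga ^+ 2 - 200 * (50 / 53).
  by rewrite /s; field.
have : q ^+ 2 <= q ^+ 2 * s.
  rewrite ler_peMr ?sqr_ge0 // /s.
  have : q * (1 / (20 * 100)) <= q * (2 * ga - 33 / 35 - 50 / 53).
    by rewrite ler_wpM2l ?(ltW q0) //; lra.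
  have := sqr_ge0 ga; lra.
have : q * (36 * ga + 200) <= q * 300 by rewrite ler_wpM2l ?(ltW q0) //; lra.
have : ga ^+ 2 <= 1 by rewrite expr_le1 // ltW.
lra.
Qed.

Lemma sidon_card_le (R : realType) (M : nat) (S : {set 'I_M.+1}) (q ga : R) :
  sidon_ord S ->
  50 / 53 <= ga <= 1 -> 200 * 300 <= q -> q ^+ 4 = M.+1%:R ->
  #|S|%:R <= q ^+ 2 + ga * q.
Proof.
move=> sidS gaP qK q4.
have q0 : 0 < q by lra.
have q3 : q <= q ^+ 3.
  by rewrite [leRHS]exprSr ler_peMl ?(ltW q0) // exprn_ege1; lra.
have q41 : 100 * q <= q ^+ 4.
  by rewrite [leRHS]exprS; apply: ler_pM => //; rewrite ?(ltW q0) //; lra.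
pose x := 41 / 29 * q ^+ 3.
have x0 : 0 <= x by rewrite /x; lra.
pose T := (Num.truncn x).+1.
have /andP[t1 t2] := truncn_itv x0.
have Thi : T%:R <= x + 1 by rewrite /T -natr1; lra.
have Mq : M%:R = q ^+ 4 - 1 by rewrite q4 -natr1; ring.
have M1 : 1 < M%:R :> R by rewrite Mq; lra.
set e := pi / 2 / M%:R * T%:R : R.
(* Bounding [pi / 2] by 2 gives about [82 / 29], which is below 3. *)
have eq3 : e * q <= 3.
  have -> : e * q = pi / 2 * (T%:R * q) / M%:R by rewrite /e; field; lra.
  rewrite ler_pdivrMr; last lra.
  apply: (@le_trans _ _ (2 * (T%:R * q))).
    by rewrite ler_wpM2r ?mulr_ge0 ?(ltW q0) // ltW // pihalf_lt2.
  have : T%:R * q <= (x + 1) * q by rewrite ler_wpM2r // ltW.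
  have -> : (x + 1) * q = 41 / 29 * q ^+ 4 + q by rewrite /x; ring.
  by rewrite Mq; lra.
have e0 : 0 <= e.
  by rewrite mulr_ge0 // divr_ge0 // divr_ge0 // pi_ge0.
have e1 : e <= 1.
  by rewrite -(ler_pM2r q0); lra.
have M1' : (1 < M)%N by rewrite -(ltr_nat R).
have := sidon_card_ineq M1' (ltn0Sn _ : (0 < T)%N) e1 sidS.
rewrite -q4; apply: asymptotic_card_le => //.
by apply/andP; split => //; exact: ltW.
Qed.

(* The lower bound on gamma0 is 0.94349, split because large unary numerals
   such as 94349 overflow the stack. *)
Theorem theorem1p2 (R : realType) :
  exists gamma0 : R,
    943 / 10 ^+ 3 + 49 / 10 ^+ 5 <= gamma0 < 9435 / 10 ^+ 4 /\
    exists C : R, forall N : nat, (0 < N)%N ->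
      (F N)%:R <= N%:R `^ (1 / 2) + gamma0 * N%:R `^ (1 / 4) + C.
Proof.
pose ga : R := 943 / 10 ^+ 3 + 49 / 10 ^+ 5.
exists ga; split; first by rewrite lexx /ga /=; lra.
have gaP : 50 / 53 <= ga <= 1 by rewrite /ga; lra.
have ga0 : 0 <= ga by rewrite /ga; lra.
clearbody ga; pose K : R := 200 * 300.
(* For [q < K] the trivial bound [F N <= N = q ^ 4] is absorbed by this constant. *)
exists (K ^+ 4) => -[//|M] _.
have C0 : 0 <= K ^+ 4 by rewrite exprn_ge0 // mulr_ge0.
set q : R := M.+1%:R `^ (1 / 4).
have q0 : 0 <= q by exact: powR_ge0.
have q4 : q ^+ 4 = M.+1%:R.
  by rewrite -powR_mulrn // -powRrM mul1r mulVf ?powRr1.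
have -> : M.+1%:R `^ (1 / 2) = q ^+ 2.
  by rewrite -powR_mulrn // -powRrM; congr (_ `^ _); field.
have [S -> sidS] := F_attained M.+1.
have [qK|Kq] := ltP q K; last first.
  by rewrite -[leLHS]addr0 lerD // sidon_card_le.
rewrite -[leLHS]add0r lerD //.
  by rewrite addr_ge0 ?sqr_ge0 // mulr_ge0.
apply: (@le_trans _ _ (q ^+ 4)).
  by rewrite q4 ler_nat -[leqRHS]card_ord max_card.
by rewrite lerXn2r ?nnegrE // ltW // (le_lt_trans q0).
Qed.
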